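(* Let $p$ be a prime with $p\equiv3\pmod4$ and $n_0=\frac{p^2-1}{2}$. Let $(n,k)$ be integers with $1\le k\le n_0<n$, and let $\lambda$ be an unordered partition of $2n$ into $2k$ parts, all parts odd, all parts less than $p^2$, and no part equal to $p$. Writing $c_i$ for the number of parts of $\lambda$ equal to $i$ ($1\le i\le 2n$), $$\omega_p\!\left(\frac{(2n)!}{\prod_{i=1}^{2n} i!^{c_i}\,c_i!}\right)>0.$$
   Context: $\omega_p(x)$ denotes the $p$-adic valuation of a positive integer $x$ (the largest $\alpha$ with $p^\alpha\mid x$); the quantity $\frac{(2n)!}{\prod_i i!^{c_i}c_i!}$ is a positive integer. *)

(* Defs.v *)
From mathcomp Require Import all_boot.

Set Implicit Arguments.
Unset Strict Implicit.
Unset Printing Implicit Defensive.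

(* Unordered partitions are represented by nonincreasing sequences. *)
Definition is_partition (N : nat) (la : seq nat) : bool :=
  [&& sorted geq la, 0 \notin la & sumn la == N].

Definition mult (la : seq nat) (i : nat) : nat := count_mem i la.

Definition partition_denom (N : nat) (la : seq nat) : nat :=
  \prod_(1 <= i < N.+1) (i`! ^ mult la i * (mult la i)`!).

(* The division is exact when la is a partition of N: see partition_quotK. *)
Definition partition_quot (N : nat) (la : seq nat) : nat :=
  N`! %/ partition_denom N la.

Lemma fact_exp_dvd (i c : nat) : 0 < i -> i`! ^ c * c`! %| (i * c)`!.
Proof.
case: i => [//|i] _; elim: c => [|c IHc]; first by rewrite muln0.
have le_i : i.+1 <= i.+1 * c.+1 by rewrite leq_pmulr.
rewrite -(bin_fact le_i) {2}mulnS addKn.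
have -> : 'C(i.+1 * c.+1, i.+1) = c.+1 * 'C((i.+1 * c.+1).-1, i).
  apply/eqP; rewrite -(eqn_pmul2l (ltn0Sn i)) mulnA; apply/eqP.
  by rewrite mul_bin_diag.
rewrite expnS factS.
have -> : i.+1`! * i.+1`! ^ c * (c.+1 * c`!) =
          c.+1 * (i.+1`! * (i.+1`! ^ c * c`!)) by rewrite mulnCA -!mulnA.
by rewrite -mulnA dvdn_mul // dvdn_mull // dvdn_mul.
Qed.

Lemma sum_mult (N : nat) (la : seq nat) :
  0 \notin la -> sumn la <= N -> \sum_(1 <= i < N.+1) i * mult la i = sumn la.
Proof.
elim: la => [|x la IHla] /=.
  by move=> _ _; rewrite big1 // => i _; rewrite /mult muln0.
rewrite inE negb_or eq_sym -lt0n => /andP[x_gt0 la0] le_N.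
under eq_bigr => i _ do rewrite /mult /= mulnDr.
rewrite big_split /= IHla //; last by apply: leq_trans le_N; rewrite leq_addl.
congr (_ + _); rewrite (bigD1_seq x) ?iota_uniq //=; last first.
  by rewrite mem_index_iota x_gt0 ltnS (leq_trans (leq_addr _ _) le_N).
rewrite eqxx muln1 big1 ?addn0 // => i /negPf nix.
by rewrite eq_sym nix muln0.
Qed.

Lemma partition_denom_dvd (N : nat) (la : seq nat) :
  is_partition N la -> partition_denom N la %| N`!.
Proof.
case/and3P=> _ la0 /eqP sum_la.
suff H M : \prod_(1 <= i < M.+1) (i`! ^ mult la i * (mult la i)`!)
           %| (\sum_(1 <= i < M.+1) i * mult la i)`!.
  by have := H N; rewrite (sum_mult la0) ?sum_la.
elim: M => [|M IHM]; first by rewrite !big_nil.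
rewrite !(@big_nat_recr _ _ _ M.+1 1) //=.
set a := \sum_(1 <= i < M.+1) _ in IHM *; set b := M.+1 * _.
rewrite -(bin_fact (leq_addl a b)) addnK dvdn_mull // mulnC.
by rewrite dvdn_mul // fact_exp_dvd.
Qed.

Lemma partition_quotK (N : nat) (la : seq nat) :
  is_partition N la -> partition_quot N la * partition_denom N la = N`!.
Proof. by move=> la_part; rewrite divnK ?partition_denom_dvd. Qed.

(* Main.v *)
Require Import Defs.
From mathcomp Require Import all_boot.
From mathcomp Require Import zify.

(** Write [c_i] for the multiplicity of [i].  If some [i > 1] has [c_i >= p],
    then [p] already divides the factor [(i c_i)! / (i!^c_i c_i!)] of the
    quotient: this reduces to [c_i = p], where Legendre's formula gives
    valuation [i + floor(i/p) - p floor(i/p) - 1], which is positive unless [i]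
    is [1] or [p].  Otherwise, since all parts and [c_1] are below [p^2], the
    valuation of the denominator is at most [sum_i floor(i c_i / p)
    <= floor(2n/p)], while [2n >= p^2] makes the valuation of [(2n)!] strictly
    larger than [floor(2n/p)]. *)

Lemma logn_fact_rec (p m : nat) :
  prime p -> logn p m`! = m %/ p + logn p (m %/ p)`!.
Proof.
move=> p_prime; have p_gt1 := prime_gt1 p_prime.
case: (posnP m) => [->|m_gt0]; first by rewrite div0n.
have lt_m : m %/ p < m by rewrite ltn_Pdiv.
rewrite !logn_fact // big_ltn // expn1; congr (_ + _).
(* Since floor(m/p^(k+1)) = floor(floor(m/p)/p^k), the shifted tail is Legendre's sum for [m %/ p]
   plus terms with k > floor(m/p), which vanish because k < p^k. *)
rewrite big_add1 /= (@big_cat_nat _ _ _ (m %/ p).+1) //=.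
rewrite [X in _ + X]big_nat_cond [X in _ + X]big1 ?addn0 => [|k].
  by apply: eq_bigr => k _; rewrite expnS divnMA.
case/andP=> /andP[le_k _] _; rewrite expnS divnMA divn_small //.
exact: leq_trans le_k (ltnW (ltn_expl k p_gt1)).
Qed.

Lemma logn_fact_small (p m : nat) : m < p -> logn p m`! = 0.
Proof.
move=> lt_mp; case p_prime: (prime p); last by rewrite /logn p_prime.
by rewrite logn_fact_rec // divn_small // logn1.
Qed.

Lemma logn_fact_lt_sqr (p m : nat) :
  prime p -> m < p ^ 2 -> logn p m`! = m %/ p.
Proof.
move=> p_prime lt_m; rewrite logn_fact_rec // logn_fact_small ?addn0 //.
by rewrite ltn_divLR ?prime_gt0.
Qed.

(** Here floor(m/p) >= p, so [p] divides the factorial of [m %/ p] left over in the recursion. *)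
Lemma logn_fact_ge_sqr (p m : nat) :
  prime p -> p ^ 2 <= m -> m %/ p < logn p m`!.
Proof.
move=> p_prime le_m; have p_gt0 := prime_gt0 p_prime.
rewrite logn_fact_rec // -[ltnLHS]addn0 ltn_add2l logn_gt0 mem_primes p_prime.
by rewrite fact_gt0 dvdn_fact // p_gt0 leq_divRL.
Qed.

(** The quotient is a multinomial coefficient, built up as a product of binomials. *)
Lemma prod_fact_dvd (I : Type) (s : seq I) (F : I -> nat) :
  \prod_(i <- s) (F i)`! %| (\sum_(i <- s) F i)`!.
Proof.
elim: s => [|i s IHs]; first by rewrite !big_nil.
rewrite !big_cons -(bin_fact (leq_addr _ (F i))) addKn dvdn_mull //.
by rewrite dvdn_mul.
Qed.

(** Induction on [c] from the base case c = p: passing from c to c+1 multiplies (ic)!/(i!^c c!) by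
    the integer binomial(i(c+1)-1, i-1), so a factor [p] is never lost. *)
Lemma dvd_fact_exp_ge (p i c : nat) : prime p -> 1 < i -> i < p ^ 2 -> i != p ->
  p <= c -> p * (i`! ^ c * c`!) %| (i * c)`!.
Proof.
move=> p_prime i_gt1 lt_i i_neq_p; have p_gt1 := prime_gt1 p_prime.
have i_gt0 := ltnW i_gt1.
have D_gt0 j : 0 < i`! ^ j * j`! by rewrite muln_gt0 expn_gt0 !fact_gt0.
elim: c => [|c IHc]; first by rewrite leqNgt (ltnW p_gt1).
rewrite leq_eqVlt => /orP[/eqP <-|].
  have /dvdnP[q def_q] := fact_exp_dvd p i_gt0.
  have q_gt0 : 0 < q.
    by have := fact_gt0 (i * p); rewrite def_q muln_gt0 => /andP[].
  rewrite def_q dvdn_mul //.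
  suff: 0 < logn p q by rewrite logn_gt0 mem_primes => /and3P[].
  have p_gt0 := ltnW p_gt1.
  have lt_p : p < p ^ 2 by rewrite ltn_Pmull.
  have := congr1 (logn p) def_q.
  rewrite (lognM p q_gt0 (D_gt0 p)) lognM ?expn_gt0 ?fact_gt0 // lognX.
  rewrite (logn_fact_rec p (i * p)) // mulnK //.
  rewrite !logn_fact_lt_sqr // divnn p_gt0.
  (* The valuation of [q] is this sum minus 1. The sum is the base-p digit sum of [i], which for 0 <
     i < p^2 equals 1 only at i = 1 and i = p. *)
  suff: 1 < i %/ p + i %% p by have := divn_eq i p; lia.
  have := divn_eq i p; case: (i %/ p) => [|[|a]]; lia.
rewrite ltnS => /IHc; case: i i_gt1 {lt_i i_neq_p IHc i_gt0 D_gt0} => // i _ IHc.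
have le_i : i.+1 <= i.+1 * c.+1 by rewrite leq_pmulr.
rewrite -(bin_fact le_i) {2}mulnS addKn.
have -> : 'C(i.+1 * c.+1, i.+1) = c.+1 * 'C((i.+1 * c.+1).-1, i).
  apply/eqP; rewrite -(eqn_pmul2l (ltn0Sn i)) mulnA; apply/eqP.
  by rewrite mul_bin_diag.
have -> : p * (i.+1`! ^ c.+1 * c.+1`!) =
          c.+1 * (i.+1`! * (p * (i.+1`! ^ c * c`!))).
  by rewrite expnS (factS c) mulnACA mulnCA [_ * c.+1]mulnC -mulnA.
by rewrite -mulnA dvdn_mul // dvdn_mull // dvdn_mul.
Qed.

(** The quotient factors as the multinomial N!/prod_j (j c_j)! times the integers (j c_j)!/(j!^c_j
    c_j!), so a divisor of the factor at [i] divides the whole. *)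
Lemma dvd_partition_quot (d N i : nat) (la : seq nat) :
  is_partition N la -> 0 < i <= N ->
  d * (i`! ^ mult la i * (mult la i)`!) %| (i * mult la i)`! ->
  d %| partition_quot N la.
Proof.
move=> la_part i_bd dvd_i.
have denom_gt0 : 0 < partition_denom N la.
  by apply: prodn_gt0 => j; rewrite muln_gt0 expn_gt0 !fact_gt0.
rewrite -(dvdn_pmul2r denom_gt0) partition_quotK //.
case/and3P: la_part => _ la0 /eqP sum_la.
have i_in : i \in index_iota 1 N.+1 by rewrite mem_index_iota ltnS.
rewrite -[X in X`!]sum_la -(@sum_mult N) ?sum_la //.
apply: dvdn_trans (prod_fact_dvd _ _ _).
rewrite /partition_denom !(bigD1_seq i) ?iota_uniq //= mulnA dvdn_mul //.
rewrite big_seq_cond [X in _ %| X]big_seq_cond.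
elim/big_ind2: _ => [//|x y z t|j]; first exact: dvdn_mul.
rewrite mem_index_iota => /andP[/andP[j_gt0 _] _]; exact: fact_exp_dvd.
Qed.

Lemma leq_sum_div (I : Type) (s : seq I) (F : I -> nat) (d : nat) :
  \sum_(i <- s) F i %/ d <= (\sum_(i <- s) F i) %/ d.
Proof.
elim: s => [|i s IHs]; first by rewrite !big_nil.
rewrite !big_cons; case: (posnP d) => [->|d_gt0]; first by rewrite !divn0 big1.
apply: leq_trans (leq_add (leqnn _) IHs) _.
by rewrite leq_divRL // mulnDl leq_add ?leq_divM.
Qed.

Lemma logn_prod (I : Type) (s : seq I) (F : I -> nat) (p : nat) :
  (forall i, 0 < F i) ->
  logn p (\prod_(i <- s) F i) = \sum_(i <- s) logn p (F i).
Proof.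
move=> F_gt0; elim: s => [|i s IHs]; first by rewrite !big_nil logn1.
by rewrite !big_cons lognM ?IHs // prodn_gt0.
Qed.

Lemma logn_partition_denom_le (p N : nat) (la : seq nat) :
  prime p -> is_partition N la -> (forall i, i \in la -> i < p ^ 2) ->
  mult la 1 < p ^ 2 -> (forall i, 1 < i -> mult la i < p) ->
  logn p (partition_denom N la) <= N %/ p.
Proof.
move=> p_prime /and3P[_ la0 /eqP sum_la] la_lt c1_lt c_lt.
have term_gt0 j : 0 < j`! ^ mult la j * (mult la j)`!.
  by rewrite muln_gt0 expn_gt0 !fact_gt0.
rewrite /partition_denom logn_prod //.
rewrite -[X in _ <= X %/ _]sum_la -(@sum_mult N) ?sum_la //.
apply: leq_trans (leq_sum_div _ _ _ _).
rewrite big_seq_cond [leqRHS]big_seq_cond.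
apply: leq_sum => j; rewrite mem_index_iota => /andP[/andP[j_gt0 _] _].
rewrite lognM ?expn_gt0 ?fact_gt0 // lognX.
have [j_le1|j_gt1] := leqP j 1.
  have -> : j = 1 by apply/eqP; rewrite eqn_leq j_le1.
  by rewrite logn1 muln0 mul1n logn_fact_lt_sqr.
rewrite (logn_fact_small p (mult la j)) ?c_lt // addn0.
(* The index [j] runs up to [N] and may exceed p^2; the bound j < p^2 holds only when [j] is a
   part. *)
have [->//|c_gt0] := posnP (mult la j).
rewrite logn_fact_lt_sqr //; last by rewrite la_lt // -has_pred1 has_count.
(* This is c_j floor(j/p) <= floor(j c_j/p). *)
by rewrite leq_divRL ?prime_gt0 // -mulnA [leqRHS]mulnC leq_mul2l leq_divM orbT.
Qed.

Theorem theorem20 (p n k : nat) (la : seq nat)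
    (p_prime : prime p) (p_mod4 : p = 3 %[mod 4])
    (k_ge1 : 1 <= k) (k_le_n0 : k <= (p ^ 2 - 1) %/ 2)
    (n0_lt_n : (p ^ 2 - 1) %/ 2 < n)
    (la_part : is_partition (2 * n) la) (la_size : size la = 2 * k)
    (la_odd : forall x, x \in la -> odd x)
    (la_lt : forall x, x \in la -> x < p ^ 2)
    (la_neq_p : forall x, x \in la -> x <> p) :
  0 < logn p (partition_quot (2 * n) la).
Proof.
have p2_gt0 : 0 < p ^ 2 by rewrite expn_gt0 prime_gt0.
have quot_gt0 : 0 < partition_quot (2 * n) la.
  by have := fact_gt0 (2 * n); rewrite -(partition_quotK la_part) muln_gt0 => /andP[].
have [/hasP[i i_la /andP[i_gt1 c_ge]]|/hasPn c_small] :=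
    boolP (has (fun i => (1 < i) && (p <= mult la i)) la).
  rewrite logn_gt0 mem_primes p_prime quot_gt0 /=.
  apply: (dvd_partition_quot p _ i) => //; last first.
    by apply: dvd_fact_exp_ge => //; [apply: la_lt | apply/eqP/la_neq_p].
  rewrite (ltnW i_gt1) /=; case/and3P: la_part => _ _ /eqP <-.
  by rewrite sumnE (big_rem i) //= leq_addr.
have c_lt i : 1 < i -> mult la i < p.
  move=> i_gt1; have [i_la|/count_memPn] := boolP (i \in la).
    by have := c_small i i_la; rewrite i_gt1 -ltnNge.
  by rewrite /mult => ->; rewrite prime_gt0.
have c1_lt : mult la 1 < p ^ 2.
  (* The number of ones is at most the number of parts, 2k <= p^2 - 1. *)
  by apply: leq_ltn_trans (count_size _ _) _; rewrite la_size; lia.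
have p2_le : p ^ 2 <= 2 * n by lia.
rewrite /partition_quot logn_div ?partition_denom_dvd // subn_gt0.
apply: leq_ltn_trans (logn_fact_ge_sqr _ _ p_prime p2_le).
exact: logn_partition_denom_le.
Qed.
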